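(* There exists a coloring (partition) $\mathbb{N}=C_1\cup C_2\cup C_3$ where the sets $C_1,C_2,C_3$ are all syndetic and there is no monochromatic sumset $B+B$ for any infinite set $B\subset\mathbb{N}$; that is, for no infinite $B\subset\mathbb{N}$ and no $i\in\{1,2,3\}$ does one have $B+B\subset C_i$.
   Context: $\mathbb{N}=\{1,2,3,\dots\}$. $B+B=\{b_1+b_2 : b_1,b_2\in B\}$ (the case $b_1=b_2$ is allowed). A set $A\subset\mathbb{N}$ is syndetic if there is $d\in\mathbb{N}$ such that $\mathbb{N}\subset A\cup(A-1)\cup\cdots\cup(A-d)$, where $A-j=\{a-j:a\in A\}$. *)

(* Defs.v *)
From mathcomp Require Import all_boot.
From mathcomp Require Import boolp classical_sets functions cardinality.

Set Implicit Arguments.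
Unset Strict Implicit.
Unset Printing Implicit Defensive.

Local Open Scope nat_scope.
Local Open Scope classical_set_scope.

Definition posnats : set nat := [set n | 0 < n].

Definition sumset (A B : set nat) : set nat :=
  [set a + b | a in A & b in B].

(* The part of A - j = {a - j : a in A} lying in nat, without truncation:
   n = a - j for some a in A iff n + j is in A. *)
Definition shift (A : set nat) (j : nat) : set nat := [set n | A (n + j)].

Definition syndetic (A : set nat) : Prop :=
  A `<=` posnats /\
  exists2 d, 0 < d & posnats `<=` \bigcup_(j < d.+1) shift A j.

(* Main.v *)
Require Import Defs.
From mathcomp Require Import all_boot.
From mathcomp Require Import boolp classical_sets functions cardinality.
From mathcomp Require Import zify.

Local Open Scope nat_scope.
Local Open Scope classical_set_scope.

(** Let [halflog n] be the integer part of 2 log_2 n.  Doubling n adds exactly 2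
    to it, while moving from n to n + b with 3 b <= n adds 0 or 1.  Hence
    n + n and n + b have distinct values of [halflog] modulo 3
    ([halflog_double_neq]), and colouring by this residue leaves no infinite B
    with B + B monochromatic.  The colour classes however have longer and longer
    gaps, so they are not syndetic.

    The remedy is that only even sums matter: an infinite B contains b and n of
    the same parity with 3 b <= n ([same_parity_sparse_pair]), and then n + n
    and n + b are both even.  So the odd numbers may be coloured freely, and
    colouring them with period 6 in the three colours makes every class
    syndetic. *)

Definition halflog (n : nat) : nat := trunc_log 2 (n ^ 2).

Lemma halflog_double n : 0 < n -> halflog (n + n) = halflog n + 2.
Proof.
move=> n_gt0; rewrite /halflog addnn -muln2 expnMn.
have -> : n ^ 2 * 2 ^ 2 = 2 * (2 * n ^ 2) by lia.
by rewrite !trunc_logMp ?muln_gt0 ?expn_gt0 ?n_gt0 // addn2.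
Qed.

(** The ratio (n + b) / n is at most 4/3, which is less than the square root
    of 2, the width of one step of [halflog]. *)
Lemma halflog_add_small n b : 0 < n -> 3 * b <= n ->
  halflog n <= halflog (n + b) <= (halflog n).+1.
Proof.
move=> n_gt0 le_b; rewrite /halflog leq_trunc_log ?leq_exp2r ?leq_addr //=.
rewrite -trunc_logMp ?expn_gt0 ?n_gt0 //.
by apply: leq_trunc_log; nia.
Qed.

Lemma halflog_double_neq n b : 0 < n -> 3 * b <= n ->
  halflog (n + n) %% 3 != halflog (n + b) %% 3.
Proof.
move=> n_gt0 le_b; rewrite halflog_double //.
have := halflog_add_small n b n_gt0 le_b; lia.
Qed.

Definition color (n : nat) : nat :=
  if odd n then (n %% 6)./2 else halflog n %% 3.

Lemma color_lt3 n : color n < 3.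
Proof. by rewrite /color; case: ifP => _; lia. Qed.

Definition color_class (i : 'I_3) : set nat :=
  [set n | 0 < n /\ color n = i].

Lemma color_class_near (i : 'I_3) (n : nat) :
  exists2 j, j < 6 & color_class i (n + j).
Proof.
(* As 5 is -1 modulo 6, this makes n + j congruent to 2 i + 1. *)
exists ((i.*2.+1 + 5 * n) %% 6); first by rewrite ltn_mod.
have i_lt3 := ltn_ord i.
set m := n + _; have m_mod : m %% 6 = i.*2.+1 by rewrite /m; lia.
have m_odd : odd m by lia.
by split; [lia | rewrite /color m_odd m_mod; lia].
Qed.

Lemma syndetic_color_class (i : 'I_3) : syndetic (color_class i).
Proof.
split=> [n [] //|]; exists 5 => // n _.
by have [j j_lt6 Cj] := color_class_near i n; exists j.
Qed.

Lemma partition_color_class :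
  classical_sets.partition [set: 'I_3] color_class posnats.
Proof.
split.
- apply/seteqP; split=> [n [i _ []] //|n n_gt0].
  by exists (Ordinal (color_lt3 n)).
- by move=> i j _ _ [n [[_ ci] [_ cj]]]; apply: val_inj; rewrite /= -ci -cj.
- by move=> i _; have [j _ Cj] := color_class_near i 0; exists (0 + j).
Qed.

Lemma infinite_set_unbounded (B : set nat) (m : nat) :
  infinite_set B -> exists2 n, B n & m <= n.
Proof.
move=> Binf; apply: contrapT => noB; apply: Binf.
apply: (sub_finite_set _ (finite_II m)) => n Bn /=.
by rewrite ltnNge; apply/negP => le_mn; apply: noB; exists n.
Qed.

(** Among three elements, each at least three times the preceding one, two
    have the same parity. *)
Lemma same_parity_sparse_pair (B : set nat) : infinite_set B ->
  exists b n, [/\ B b, B n, 3 * b <= n & odd b = odd n].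
Proof.
move=> Binf.
have [x Bx _] := infinite_set_unbounded B 0 Binf.
have [y By le_xy] := infinite_set_unbounded B (3 * x) Binf.
have [z Bz le_yz] := infinite_set_unbounded B (3 * y) Binf.
have [xy|xy] := eqVneq (odd x) (odd y); first by exists x, y.
have [yz|yz] := eqVneq (odd y) (odd z); first by exists y, z.
by exists x, z; split=> //; lia.
Qed.

Theorem proposition1p5 :
  exists C : 'I_3 -> set nat,
    [/\ classical_sets.partition [set: 'I_3] C posnats,
        forall i : 'I_3, syndetic (C i)
      & forall B : set nat, B `<=` posnats -> infinite_set B ->
          forall i : 'I_3, ~ (sumset B B `<=` C i)].
Proof.
exists color_class; split; first exact: partition_color_class.
  exact: syndetic_color_class.
move=> B Bpos Binf i subC.
have [b [n [Bb Bn le_bn parity]]] := same_parity_sparse_pair B Binf.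
have [_ cnn] : color_class i (n + n) by apply: subC; exists n => //; exists n.
have [_ cnb] : color_class i (n + b) by apply: subC; exists n => //; exists b.
move: cnn cnb; rewrite /color !oddD parity addbb /= => cnn cnb.
have := halflog_double_neq n b (Bpos n Bn) le_bn.
by rewrite cnn cnb eqxx.
Qed.
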